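(* Let ${\cal F}=(V,E)$ be a hypergraph with $V=[n]$ and all hyperedges of size at most $d$. Let $s$ be any positive integer with $s\leq d$, and let $b_1,\ldots,b_s$ be integers with $d>b_1>\cdots>b_s=1$; set $b_0=d$. Then there exists an $s$-stage group testing algorithm that finds the defective hyperedge in $E$ and uses $$O\left(\frac{d}{b_1}\log|E|+\sum_{i=2}^{s}\left(\frac{b_{i-1}}{b_i}\log|E|+b_{i-2}\right)\right)$$ tests.
   Context: Group testing on a hypergraph: $E$ is a family of subsets (hyperedges) of $[n]=\{1,\ldots,n\}$. An unknown hyperedge $e^*\in E$, the defective hyperedge, is the set of all defective elements. A test is a subset $T\subseteq[n]$ whose response is ''yes'' if $T\cap e^*\neq\emptyset$ and ''no'' otherwise. An $s$-stage algorithm performs its tests in $s$ successive stages; all tests of a stage are decided at the beginning of the stage (they may depend on responses of earlier stages, but not on responses of the same or later stages). The algorithm finds the defective hyperedge if, for every possible $e^*\in E$, it outputs $e^*$. The number of tests is the total number over all stages in the worst case; the $O(\cdot)$ hides an absolute constant. Logarithms are base 2. *)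

(* Defs.v *)
From mathcomp Require Import all_boot all_order all_algebra.
From mathcomp Require Import reals exp.

Set Implicit Arguments.
Unset Strict Implicit.
Unset Printing Implicit Defensive.

Import Order.TTheory GRing.Theory Num.Theory.

Definition response (n : nat) (T e : {set 'I_n}) : bool := T :&: e != set0.

(* [algorithm n s]: an [s]-stage algorithm on the vertex set ['I_n]. The [k]
   tests of a stage are fixed when the stage starts; the rest of the algorithm
   depends on their [k] responses. [k] may be 0, and it may vary with the
   responses of the earlier stages. *)
Inductive algorithm (n : nat) : nat -> Type :=
| Output of {set 'I_n} : algorithm n 0
| Stage (s k : nat) of k.-tuple {set 'I_n} & (k.-tuple bool -> algorithm n s) :
    algorithm n s.+1.

Fixpoint output (n s : nat) (A : algorithm n s) (e : {set 'I_n}) : {set 'I_n} :=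
  match A with
  | Output f => f
  | Stage _ _ tests next =>
      output (next (map_tuple (fun T => response T e) tests)) e
  end.

Fixpoint num_tests (n s : nat) (A : algorithm n s) (e : {set 'I_n}) : nat :=
  match A with
  | Output _ => 0
  | Stage _ k tests next =>
      k + num_tests (next (map_tuple (fun T => response T e) tests)) e
  end.

Definition finds_defective (n s : nat) (A : algorithm n s)
    (E : {set {set 'I_n}}) : Prop :=
  forall e, e \in E -> output A e = e.

Definition worst_case_tests (n s : nat) (A : algorithm n s)
    (E : {set {set 'I_n}}) : nat :=
  \max_(e in E) num_tests A e.

Local Open Scope ring_scope.

Definition log2 (R : realType) (x : R) : R := ln x / ln 2.

(* Main.v *)
Require Import Defs.
From mathcomp Require Import all_boot all_order all_algebra.
From mathcomp Require Import reals sequences exp.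
From mathcomp Require Import ring lra.

(* A random set containing each vertex with probability 1/(2m) separates a fixed
   pair of hyperedges e, e' with at most m vertices and |e \ e'| >= b, i.e. meets
   e but not e', with probability at least b/(8m). Greedily choosing such sets,
   O((m/b) log |E|) tests separate all these pairs. Stage 1 uses this with m = d
   and b = b_1, so the surviving candidates have pairwise differences smaller than
   b_1. Stage i >= 2 fixes a surviving candidate e0, tests its not yet determined
   vertices one by one (at most b_(i-2) of them), and separates the candidates
   outside the determined vertices, where they have at most b_(i-1) vertices, with
   b = b_i. Since b_s = 1, a single candidate is left at the end. *)

Set Implicit Arguments.
Unset Strict Implicit.
Unset Printing Implicit Defensive.

Import Order.TTheory GRing.Theory Num.Theory.
Local Open Scope ring_scope.

(** * Success probability of one random test *)

Lemma bernoulli_sub (R : realFieldType) (x : R) (k : nat) :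
  0 <= x <= 1 -> 1 - k%:R * x <= (1 - x) ^+ k.
Proof.
move=> /andP[x0 x1]; elim: k => [|k IHk]; first by rewrite mul0r subr0 expr0.
rewrite exprS -natr1.
have : (1 - x) * (1 - k%:R * x) <= (1 - x) * (1 - x) ^+ k.
  by rewrite ler_wpM2l // subr_ge0.
have : 0 <= k%:R * x * x by rewrite !mulr_ge0.
nra.
Qed.

(** With [q = 1 - 1/(2m)], the difference is the probability of missing [u] vertices and hitting one
    of [v] others. It factors as [q^u (1 - q^v)]. Bernoulli gives [q^k >= 1/2] for [k <= m], and
    [1 - q^b] is [1/(2m)] times a sum of [b] such powers. *)
Lemma hit_prob_ge (R : realFieldType) (m b u v : nat) :
  (0 < m)%N -> (b <= m)%N -> (u <= m)%N -> (b <= v)%N ->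
  b%:R / (8 * m)%:R <=
  (1 - (2 * m)%:R^-1) ^+ u - (1 - (2 * m)%:R^-1) ^+ (u + v) :> R.
Proof.
move=> m0 bm um bv; set q : R := 1 - _.
have mR : 0 < m%:R :> R by rewrite ltr0n.
have M0 : 0 < (2 * m)%:R :> R by rewrite ltr0n muln_gt0.
have x1 : 0 <= ((2 * m)%:R^-1 : R) <= 1.
  by rewrite invr_ge0 ltW //= invf_le1 // ler1n muln_gt0.
have q01 : 0 <= q <= 1.
  case/andP: x1 => x0 x1; rewrite subr_ge0 x1 /= lerBlDr lerDl //.
have qm k : (k <= m)%N -> 2^-1 <= q ^+ k.
  move=> km; apply: le_trans (bernoulli_sub k x1).
  rewrite natrM invfM.
  have : k%:R / m%:R <= 1 :> R by rewrite ler_pdivrMr // mul1r ler_nat.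
  lra.
have hv : b%:R / (4 * m)%:R <= 1 - q ^+ v.
  apply: (@le_trans _ _ (1 - q ^+ b)); last first.
    case/andP: q01 => q0 q1.
    by rewrite lerD2l lerN2 -(subnKC bv) exprD ler_piMr ?exprn_ge0 ?exprn_ile1.
  have -> : 1 - q ^+ b = (2 * m)%:R^-1 * \sum_(i < b) q ^+ i.
    by rewrite -opprB subrX1 -mulNr /q; congr (_ * _); ring.
  have : b%:R / 2 <= \sum_(i < b) q ^+ i.
    rewrite mulr_natl -[b in _ *+ b]card_ord -sumr_const.
    by apply: ler_sum => i _; apply: qm; apply: leq_trans bm; apply: ltnW.
  move=> h; apply: (@le_trans _ _ ((2 * m)%:R^-1 * (b%:R / 2))).
    by rewrite !natrM le_eqVlt; apply/orP; left; apply/eqP; field; rewrite gt_eqF.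
  by rewrite ler_pM2l // invr_gt0.
have -> : q ^+ u - q ^+ (u + v) = q ^+ u * (1 - q ^+ v).
  by rewrite exprD mulrBr mulr1.
have -> : b%:R / (8 * m)%:R = 2^-1 * (b%:R / (4 * m)%:R) :> R.
  by rewrite !natrM; field; rewrite gt_eqF.
by apply: ler_pM; rewrite ?divr_ge0 ?invr_ge0 ?qm.
Qed.

(** Counting model of the random set: for uniform [f], each vertex lies in it independently with
    probability [1/(M+1)]. Below, [M+1 = 2m]. *)
Definition zero_set (n M : nat) (f : {ffun 'I_n -> 'I_M.+1}) : {set 'I_n} :=
  [set x | f x == ord0].

Lemma card_avoiding (R : realFieldType) (n M : nat) (e : {set 'I_n}) :
  #|[set f : {ffun 'I_n -> 'I_M.+1} | ~~ response (zero_set f) e]|%:R =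
  M.+1%:R ^+ n * (1 - M.+1%:R^-1) ^+ #|e| :> R.
Proof.
pose F x := if x \in e then predC1 (ord0 : 'I_M.+1) else predT.
rewrite (eq_card (B := family F)); last first.
  move=> f; rewrite !inE /response negbK; apply/eqP/familyP => [h x|h].
    rewrite /F; case: ifP => // xe; apply/negP => /eqP fx.
    by have := in_set0 x; rewrite -h !inE fx eqxx xe.
  apply/setP => x; rewrite !inE; apply/negP => /andP[fx xe].
  by have := h x; rewrite /F xe inE /= fx.
rewrite card_family foldrE big_map big_enum /= natr_prod.
transitivity
  (\prod_(x : 'I_n) (M.+1%:R * (if x \in e then 1 - M.+1%:R^-1 else 1)) : R).
  apply: eq_bigr => x _; rewrite /F; case: ifP => _; last first.
    by rewrite mulr1 cardT size_enum_ord.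
  by rewrite cardC1 card_ord mulrBr mulr1 divff ?pnatr_eq0 //= -natr1 addrK.
by rewrite big_split /= prodr_const card_ord -big_mkcond /= prodr_const.
Qed.

Definition separates (n : nat) (T : {set 'I_n}) (p : {set 'I_n} * {set 'I_n}) :=
  response T p.1 && ~~ response T p.2.

(** A set hits [e] and misses [e'] exactly when it avoids [e'] but not their union. So the count is
    a difference of two avoidance counts, with exponents [|e'|] and [|e'| + |e \ e'|]. *)
Lemma card_separating (R : realFieldType) (n m b M : nat)
    (p : {set 'I_n} * {set 'I_n}) :
  M.+1 = (2 * m)%N -> (0 < m)%N -> (b <= m)%N -> (#|p.2| <= m)%N -> (b <= #|p.1 :\: p.2|)%N ->
  (2 * m)%:R ^+ n * (b%:R / (8 * m)%:R) <=
  #|[set f : {ffun 'I_n -> 'I_M.+1} | separates (zero_set f) p]|%:R :> R.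
Proof.
case: p => e e' /= Mm m0 bm em bd.
set S := [set f | _].
pose avoiding c := [set f : {ffun 'I_n -> 'I_M.+1} | ~~ response (zero_set f) c].
have cS : (#|S| + #|avoiding (e' :|: e)| = #|avoiding e'|)%N.
  rewrite -(cardsID [set f | response (zero_set f) e] (avoiding e')).
  congr (_ + _)%N; apply: eq_card => f; rewrite !inE; first by rewrite andbC.
  by rewrite /response setIUr setU_eq0 negb_and negb_or !negbK andbC.
have := @card_avoiding R n M e'.
rewrite -cS natrD card_avoiding => /eqP; rewrite -subr_eq0 => /eqP.
have -> : #|e' :|: e| = (#|e'| + #|e :\: e'|)%N.
  by rewrite cardsU cardsD setIC addnBA // subset_leq_card ?subsetIl.
have := @hit_prob_ge R m b _ _ m0 bm em bd; rewrite -Mm.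
have : 0 <= M.+1%:R ^+ n :> R by rewrite exprn_ge0.
move=> h1 h2; have := ler_wpM2l h1 h2; rewrite mulrBr; lra.
Qed.

(** * Test families for a single stage *)

Lemma exists_good_test (R : realFieldType) (n m b : nat)
    (P : {set {set 'I_n} * {set 'I_n}}) :
  (0 < m)%N -> (b <= m)%N ->
  (forall p, p \in P -> (#|p.2| <= m)%N /\ (b <= #|p.1 :\: p.2|)%N) ->
  exists T : {set 'I_n},
    #|[set p in P | ~~ separates T p]|%:R <=
    #|P|%:R * (1 - b%:R / (8 * m)%:R) :> R.
Proof.
move=> m0 bm hP.
pose N := (2 * m).-1; pose ffT := {ffun 'I_n -> 'I_N.+1}.
have cF : #|ffT|%:R = (2 * m)%:R ^+ n :> R.
  by rewrite card_ffun !card_ord /N prednK ?muln_gt0 // natrX.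
pose c : R := b%:R / (8 * m)%:R.
(* Averaging: if every [f] separated fewer than a share [c] of [P], summing over [f] would
   contradict that each pair is separated by at least a share [c] of all [f]. *)
have [/existsP[f hf]|] :=
  boolP [exists f : ffT,
    #|P|%:R * c <= #|[set p in P | separates (zero_set f) p]|%:R].
  exists (zero_set f).
  have := cardsID [set p | separates (zero_set f) p] P.
  rewrite -setIdE.
  have -> : P :\: [set p | separates (zero_set f) p] =
      [set p in P | ~~ separates (zero_set f) p].
    by apply/setP => p; rewrite !inE andbC.
  move=> h; have : #|P|%:R = #|P|%:R :> R by [].
  rewrite -{1}h natrD -/c; lra.
rewrite negb_exists => /forallP h; exfalso.
have : \sum_(f : ffT) #|[set p in P | separates (zero_set f) p]|%:R <
    \sum_(f : ffT) #|P|%:R * c :> R.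
  apply: ltr_sum => [|f _]; last by rewrite ltNge.
  by apply/hasP; exists [ffun=> ord0] => //; rewrite mem_index_enum.
apply/negP; rewrite -leNgt.
have -> : \sum_(f : ffT) #|P|%:R * c = #|ffT|%:R * (#|P|%:R * c).
  by rewrite sumr_const -[LHS]mulr_natl.
rewrite cF.
under [leRHS]eq_bigr => f _ do rewrite -sum1_card natr_sum big_mkcond /=.
(* Count the incidences pair by pair instead; pairs outside [P] contribute nothing. *)
rewrite exchange_big /= [leRHS](bigID (mem P)) /=.
rewrite [X in _ <= _ + X]big1 ?addr0; last first.
  by move=> p pP; apply: big1 => f _; rewrite inE (negbTE pP).
have -> : (2 * m)%:R ^+ n * (#|P|%:R * c) = \sum_(p in P) (2 * m)%:R ^+ n * c :> R.
  by rewrite sumr_const -mulr_natl; ring.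
apply: ler_sum => p pP; have [p2 p1] := hP p pP.
apply: le_trans (card_separating R (M := N) _ m0 bm p2 p1) _.
  by rewrite /N prednK // muln_gt0.
rewrite -sum1_card natr_sum big_mkcond /= le_eqVlt; apply/orP; left; apply/eqP.
by apply: eq_bigr => f _; rewrite !inE pP.
Qed.

(** Each new test is chosen for the pairs that are still unseparated, so every round costs one
    factor [1 - c]. *)
Lemma greedy_tests (R : realFieldType) (n m b k : nat)
    (P : {set {set 'I_n} * {set 'I_n}}) :
  (0 < m)%N -> (b <= m)%N ->
  (forall p, p \in P -> (#|p.2| <= m)%N /\ (b <= #|p.1 :\: p.2|)%N) ->
  exists ts : k.-tuple {set 'I_n},
    #|[set p in P | ~~ has (fun T => separates T p) ts]|%:R <=
    #|P|%:R * (1 - b%:R / (8 * m)%:R) ^+ k :> R.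
Proof.
move=> m0 bm; elim: k P => [|k IHk] P hP.
  exists [tuple]; rewrite expr0 mulr1 ler_nat subset_leq_card //.
  by apply/subsetP => p; rewrite inE => /andP[].
have [T hT] := exists_good_test R m0 bm hP.
have [|ts hts] := IHk [set p in P | ~~ separates T p].
  by move=> p; rewrite inE => /andP[/hP].
exists (cons_tuple T ts); rewrite exprS mulrA.
apply: le_trans (le_trans hts _); last first.
  apply: ler_wpM2r hT; rewrite exprn_ge0 // subr_ge0.
  rewrite ler_pdivrMr ?ltr0n ?muln_gt0 //.
  by rewrite mul1r ler_nat (leq_trans bm) // leq_pmull.
rewrite ler_nat subset_leq_card //; apply/subsetP => p.
by rewrite !inE /= negb_or andbA.
Qed.

Lemma log2_ge0 (R : realType) (N : nat) : 0 <= log2 N%:R :> R.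
Proof.
rewrite /log2; case: N => [|N]; first by rewrite ln0 // mul0r.
by rewrite divr_ge0 ?ln_ge0 // ler1n.
Qed.

(** There are at most [N^2] pairs, so the greedy choice finishes once [N^2 (1 - c)^k < 1]. [N] is
    kept apart from [|G|] because [G] shrinks from stage to stage while the bound keeps [|E|]. *)
Lemma exists_separating_tests (R : realType) (n m b N : nat) (G : {set {set 'I_n}}) :
  (0 < b)%N -> (b <= m)%N -> (#|G| <= N)%N ->
  (forall e, e \in G -> (#|e| <= m)%N) ->
  exists ts : seq {set 'I_n},
    (size ts)%:R <= 17 * (m%:R / b%:R * log2 N%:R) :> R /\
    forall e e', e \in G -> e' \in G -> (b <= #|e :\: e'|)%N ->
      has (fun T => separates T (e, e')) ts.
Proof.
move=> b0 bm GN Gm.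
have m0 : (0 < m)%N := leq_trans b0 bm.
have bR : 0 < b%:R :> R by rewrite ltr0n.
have mR : 0 < m%:R :> R by rewrite ltr0n.
(* This case is separate because [log2 N] may vanish, which leaves no room for the test added by
   rounding. *)
have [G1|G2] := leqP #|G| 1.
  exists [::]; split.
    by rewrite mulr_ge0 // mulr_ge0 ?log2_ge0 // divr_ge0.
  move=> e e' eG e'G.
  by rewrite (card_le1_eqP G1 e e' eG e'G) setDv cards0 leqNgt b0.
pose P := [set p in setX G G | (b <= #|p.1 :\: p.2|)%N].
have hP p : p \in P -> (#|p.2| <= m)%N /\ (b <= #|p.1 :\: p.2|)%N.
  by rewrite !inE => /andP[/andP[_ /Gm]].
pose c : R := b%:R / (8 * m)%:R.
have c0 : 0 < c by rewrite divr_gt0 // ltr0n muln_gt0.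
have N2 : (2 <= N)%N := leq_trans G2 GN.
have N0 : 0 < N%:R :> R by rewrite ltr0n ltnW.
have lnN : 0 <= ln N%:R :> R by rewrite ln_ge0 // ler1n ltnW.
(* The successor makes [k] strictly larger than [2 ln N / c], so that
   [N^2 (1 - c)^k <= N^2 exp(-ck) < 1]. *)
pose k := (Num.truncn (ln N%:R *+ 2 / c)).+1.
have [ts hts] := greedy_tests R k m0 bm hP.
exists ts; split.
  rewrite size_tuple /k -natr1.
  have l2 : 0 < ln 2 :> R by rewrite ln_gt0 // ltr1n.
  have l1 : ln 2 <= 1 :> R.
    by have := @le_ln1Dx R 1; apply; exact: lt_trans (ltrN10 _) ltr01.
  have : (Num.truncn (ln N%:R *+ 2 / c))%:R <= ln N%:R *+ 2 / c.
    by rewrite truncn_le // divr_ge0 ?mulrn_wge0 // ltW.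
  (* Source of 17: 16 from this identity, and 1 for rounding, since [(m/b) log2 N >= 1]. *)
  have -> : ln N%:R *+ 2 / c = 16 * (m%:R / b%:R * ln N%:R).
    by rewrite /c natrM; field; rewrite !gt_eqF.
  have h1 : 1 <= m%:R / b%:R :> R by rewrite ler_pdivlMr // mul1r ler_nat.
  have h2 : ln N%:R <= log2 N%:R :> R.
    by rewrite /log2 ler_pdivlMr // ler_piMr.
  have h3 : 1 <= log2 N%:R :> R.
    by rewrite /log2 ler_pdivlMr // mul1r ler_ln ?posrE // ler_nat.
  have h4 : m%:R / b%:R * ln N%:R <= m%:R / b%:R * log2 N%:R :> R.
    by rewrite ler_wpM2l // divr_ge0.
  have h5 : 1 <= m%:R / b%:R * log2 N%:R :> R by apply: mulr_ege1.
  move=> ht; rewrite -[X in _ <= X * _](natr1 16) [leRHS]mulrDl mul1r lerD //.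
  by apply: le_trans ht _; rewrite ler_wpM2l.
have {hts} : #|[set p in P | ~~ has (fun T => separates T p) ts]|%:R < 1 :> R.
  apply: le_lt_trans hts _; rewrite -/c.
  have c1 : c <= 1.
    rewrite ler_pdivrMr ?ltr0n ?muln_gt0 // mul1r ler_nat.
    by rewrite (leq_trans bm) // leq_pmull.
  apply: (@le_lt_trans _ _ (N%:R ^+ 2 * expR (- c) ^+ k)).
    apply: ler_pM; rewrite ?exprn_ge0 ?subr_ge0 //.
      rewrite -natrX ler_nat; apply: (@leq_trans #|setX G G|).
        by rewrite subset_leq_card //; apply/subsetP => p; rewrite inE => /andP[].
      by rewrite cardsX -mulnn leq_mul.
    by rewrite lerXn2r ?nnegrE ?subr_ge0 ?expR_ge0 //; exact: expR_ge1Dx.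
  rewrite -expRM_natl -[N%:R in X in X < _]lnK ?posrE // -expRM_natl -expRD.
  rewrite -[ltRHS]expR0 ltr_expR mulrN subr_lt0 mulr_natl.
  by rewrite -ltr_pdivrMr // truncnS_gt.
rewrite (ltr_nat _ _ 1) ltnS leqn0 cards_eq0 => /eqP h e e' eG e'G bd.
apply: contraT => hn; have := in_set0 (e, e').
by rewrite -h !inE /= eG e'G bd hn.
Qed.

(* [K] is the part of the vertex set on which all candidates are known to
   agree; the vertices of [S] are tested one by one and join it. *)
Lemma exists_stage_tests (R : realType) (n m b N : nat) (G : {set {set 'I_n}})
    (K S : {set 'I_n}) :
  (0 < b)%N -> (b <= m)%N -> (#|G| <= N)%N ->
  (forall e, e \in G -> (#|e :\: (K :|: S)| <= m)%N) ->
  (forall e e', e \in G -> e' \in G -> e :&: K = e' :&: K) ->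
  exists ts : seq {set 'I_n},
    (size ts)%:R <= 17 * (m%:R / b%:R * log2 N%:R + #|S|%:R) :> R /\
    forall e e', e \in G -> e' \in G ->
      [seq response T e | T <- ts] = [seq response T e' | T <- ts] ->
      e :&: (K :|: S) = e' :&: (K :|: S) /\ (#|e :\: e'| < b)%N.
Proof.
move=> b0 bm GN Gm GK; set K' := K :|: S in Gm *.
have [||ts [tsN hts]] :=
  @exists_separating_tests R n m b N [set e :\: K' | e in G] b0 bm.
- exact: leq_trans (leq_imset_card _ _) GN.
- by move=> _ /imsetP[e eG ->]; exact: Gm.
(* Singletons reveal the candidate on [S]; removing [K'] from the other tests makes their responses
   depend only on the candidate outside [K']. *)
exists ([seq [set x] | x <- enum S] ++ [seq T :\: K' | T <- ts]); split.
  rewrite size_cat !size_map -cardE natrD mulrDr addrC lerD //.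
  by rewrite ler_peMl // ler1n.
move=> e e' eG e'G; rewrite !map_cat => /eqP.
rewrite eqseq_cat ?size_map // => /andP[/eqP hS /eqP hT].
have eK : e :&: K' = e' :&: K'.
  apply/setP => x; rewrite !inE; case: (boolP (x \in S)) => xS.
    rewrite orbT !andbT.
    move: hS; rewrite -!map_comp => /eq_in_map /(_ x).
    rewrite mem_enum xS => /(_ isT) /=; rewrite /response.
    by rewrite !setI_eq0 !disjoints1 !negbK.
  by rewrite orbF; have /setP/(_ x) := GK e e' eG e'G; rewrite !inE.
split=> //; rewrite ltnNge; apply/negP => bd.
have hR T f : response (T :\: K') f = response T (f :\: K').
  by rewrite /response !setDE setIAC setIA.
(* As [e] and [e'] agree on [K'], their difference lies outside it, so restriction keeps its size at
   least [b]; the test found here contradicts the equal responses. *)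
have /hasP[T Tts] : has (fun T => separates T (e :\: K', e' :\: K')) ts.
  apply: hts; [exact: imset_f|exact: imset_f|apply: leq_trans bd _].
  apply/subset_leq_card/subsetP => x; rewrite !inE => /andP[xe' xe].
  have /setP/(_ x) := eK; rewrite !inE xe (negbTE xe') /= => ->.
  by rewrite andbF.
move: hT; rewrite -!map_comp => /eq_in_map /(_ T Tts) /=.
by rewrite !hR /separates /= => ->; rewrite andbN.
Qed.

(** * Composing the stages into an algorithm *)

Definition solves (R : realType) (n s : nat) (A : algorithm n s)
    (G : {set {set 'I_n}}) (B : R) : Prop :=
  forall e, e \in G -> output A e = e /\ (num_tests A e)%:R <= B.

(** After responses [r], only the candidates consistent with [r] matter. The continuations, one per
    response vector, are gathered by finite choice. *)
Lemma solves_stage (R : realType) (n s : nat) (ts : seq {set 'I_n})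
    (G : {set {set 'I_n}}) (B : R) :
  (forall r : seq bool, exists A : algorithm n s,
     solves A [set e in G | [seq response T e | T <- ts] == r] B) ->
  exists A : algorithm n s.+1, solves A G ((size ts)%:R + B).
Proof.
move=> h.
pose Q (r : (size ts).-tuple bool) (A : algorithm n s) :=
  solves A [set e in G | [seq response T e | T <- ts] == r] B.
have [next hnext] := fin_all_exists (fun r => h r : exists A, Q r A).
exists (Stage (in_tuple ts) next) => e eG /=.
have [|-> B'] := hnext (map_tuple (fun T => response T e) (in_tuple ts)) e.
  by rewrite inE eG /=.
by rewrite natrD lerD2l.
Qed.

(* Here [b] is shifted: in the induction [b 0], [b 1], [b 2] are the paper's
   b_(i-2), b_(i-1), b_i for the stage i >= 2 to be performed next. *)
Lemma solves_later_stages (R : realType) (n N r : nat) (b : nat -> nat)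
    (G : {set {set 'I_n}}) (K : {set 'I_n}) :
  (#|G| <= N)%N ->
  (forall i, (i <= r)%N -> (b i.+1 < b i)%N) -> b r.+1 = 1%N ->
  (forall e, e \in G -> (#|e :\: K| <= b 0)%N) ->
  (forall e e', e \in G -> e' \in G -> e :&: K = e' :&: K) ->
  (forall e e', e \in G -> e' \in G -> (#|e :\: e'| < b 1)%N) ->
  exists A : algorithm n r, solves A G
    (17 * \sum_(0 <= i < r)
            ((b i.+1)%:R / (b i.+2)%:R * log2 N%:R + (b i)%:R) : R).
Proof.
elim: r b G K => [|r IHr] b G K GN bdec b1 Gb GK Gd.
  (* With no stage left, differences have size below [b 1 = 1], so all candidates coincide and any
     one may be output. The default occurs only for empty [G]. *)
  exists (Output (odflt set0 [pick e in G])) => e eG /=; split; last first.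
    by rewrite big_geq // mulr0.
  case: pickP => [e' e'G|/(_ e)]; last by rewrite eG.
  have sub e1 e2 : e1 \in G -> e2 \in G -> e1 \subset e2.
    by move=> e1G e2G; rewrite -setD_eq0 -cards_eq0 -leqn0 -ltnS -b1 Gd.
  by apply/eqP; rewrite eqEsubset !sub.
pose e0 := odflt set0 [pick e in G]; pose S := e0 :\: K.
have e0P e : e \in G -> e0 \in G.
  by rewrite /e0; case: pickP => // /(_ e) ->.
have Sb : (#|S| <= b 0)%N.
  by rewrite /S /e0; case: pickP => [e' /Gb //|_] /=; rewrite set0D cards0.
have b2 : (0 < b 2)%N.
  by case: r bdec b1 {IHr} => [_ ->|r /(_ 2 isT) h _] //; exact: leq_ltn_trans h.
(* Hence a candidate [e] has at most [|e \ e0| < b 1] vertices outside [K :|: S], which allows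
   [m = b 1] in this stage. *)
have KS : K :|: S = K :|: e0 by apply/setP => x; rewrite !inE; case: (x \in K).
have [||ts [tsN hts]] :=
  @exists_stage_tests R n (b 1) (b 2) N G K S b2 _ GN _ GK.
- exact/ltnW/bdec.
- move=> e eG; rewrite KS; apply: leq_trans (ltnW (Gd e e0 eG (e0P e eG))).
  by rewrite subset_leq_card // setDS // subsetUr.
pose B : R := \sum_(0 <= i < r)
  ((b i.+2)%:R / (b i.+3)%:R * log2 N%:R + (b i.+1)%:R).
have [v|A hA] := solves_stage (ts := ts) (G := G) (B := 17 * B) (s := r).
  (* The thresholds shift by one: outside the new determined set candidates have at most [b 1]
     vertices, and their differences are now below [b 2]. *)
  apply: (IHr (fun i => b i.+1) _ (K :|: S)).
  - apply: leq_trans GN; apply: subset_leq_card.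
    by apply/subsetP => e; rewrite inE => /andP[].
  - by move=> i ir; exact: bdec.
  - by [].
  - move=> e; rewrite inE => /andP[eG _]; rewrite KS.
    apply: leq_trans (ltnW (Gd e e0 eG (e0P e eG))).
    by rewrite subset_leq_card // setDS // subsetUr.
  - move=> e e'; rewrite !inE => /andP[eG /eqP ev] /andP[e'G /eqP e'v].
    by case: (hts e e' eG e'G _); rewrite // ev e'v.
  - move=> e e'; rewrite !inE => /andP[eG /eqP ev] /andP[e'G /eqP e'v].
    by case: (hts e e' eG e'G _); rewrite // ev e'v.
exists A => e eG; have [-> nA] := hA e eG; split=> //.
apply: le_trans nA _; rewrite big_nat_recl // mulrDr lerD2r.
by apply: le_trans tsN _; rewrite ler_pM2l // lerD2l ler_nat.
Qed.

Unset Implicit Arguments.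

Theorem theorem4 (R : realType) :
  exists C : R, 0 < C /\
    forall (n d : nat) (E : {set {set 'I_n}}),
      (forall e : {set 'I_n}, e \in E -> (#|e| <= d)%N) ->
    forall (s : nat) (b : nat -> nat),
      (0 < s)%N -> (s <= d)%N ->
      b 0%N = d ->
      (forall i : nat, (i < s)%N -> (b i.+1 < b i)%N) ->
      b s = 1%N ->
    exists A : algorithm n s,
      finds_defective A E /\
      (worst_case_tests A E)%:R <=
        C * (d%:R / (b 1%N)%:R * log2 #|E|%:R
             + \sum_(2 <= i < s.+1)
                 ((b (i - 1)%N)%:R / (b i)%:R * log2 #|E|%:R
                  + (b (i - 2)%N)%:R)) :> R.
Proof.
exists 17; split=> // n d E Ed [//|s] b _ _ b0 bdec b1.
have b1_gt0 : (0 < b 1)%N.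
  by case: s bdec b1 => [_ ->|s /(_ 1 isT) h _] //; exact: leq_ltn_trans h.
(* In the first stage nothing is determined and no vertex is tested singly; the size bound is
   [d]. *)
have [||e e' _ _|ts [tsN hts]] :=
  @exists_stage_tests R n d (b 1) #|E| E set0 set0 b1_gt0 _ (leqnn _).
- by rewrite -b0; exact/ltnW/bdec.
- by move=> e /Ed; rewrite setU0 setD0.
- by rewrite !setI0.
rewrite setU0 cards0 addr0 in tsN hts.
pose B : R := \sum_(0 <= i < s)
  ((b i.+1)%:R / (b i.+2)%:R * log2 #|E|%:R + (b i)%:R).
have [v|A hA] := solves_stage (ts := ts) (G := E) (B := 17 * B) (s := s).
  apply: (@solves_later_stages R n #|E| s b _ set0).
  - by apply: subset_leq_card; apply/subsetP => e; rewrite inE => /andP[].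
  - by move=> i ir; exact: bdec.
  - by [].
  - by move=> e; rewrite inE setD0 b0 => /andP[/Ed].
  - by move=> e e'; rewrite !setI0.
  - move=> e e'; rewrite !inE => /andP[eG /eqP ev] /andP[e'G /eqP e'v].
    by case: (hts e e' eG e'G _); rewrite // ev e'v.
exists A; split=> [e eE|]; first by case: (hA e eE).
have -> : \sum_(2 <= i < s.+2) ((b (i - 1)%N)%:R / (b i)%:R * log2 #|E|%:R
    + (b (i - 2)%N)%:R) = B.
  rewrite (big_addn 0 s.+2 2) subn2 /=; apply: eq_bigr => i _.
  by rewrite addnK addn2 subn1.
have B0 : 0 <= B.
  by apply: sumr_ge0 => i _; rewrite addr_ge0 // mulr_ge0 ?log2_ge0 // divr_ge0.
rewrite mulrDr /worst_case_tests.
(* The maximum over an empty [E] is 0, so the bound must also be shown nonnegative. *)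
apply: (big_ind (fun x => x%:R <= _)) => [|x y hx hy|e eE].
- by rewrite addr_ge0 // mulr_ge0 // mulr_ge0 ?log2_ge0 // divr_ge0.
- by rewrite /maxn; case: ifP.
- by have [_ /le_trans] := hA e eE; apply; rewrite lerD2r.
Qed.
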